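(* Let $(X,\tau,\mathfrak{a})$ be an $\mathfrak{a}$-space, and for $x\in X$ let $C_{\mathfrak{a}}(x)$ denote the $\mathfrak{a}$-component of $x$. Then: (a) for every $x\in X$, $C_{\mathfrak{a}}(x)$ is the maximal (i.e. largest with respect to inclusion) $\mathfrak{a}$-connected subset of $X$ containing $x$; (b) for every $x\in X$, $C_{\mathfrak{a}}(x)$ is $\mathfrak{a}$-closed; (c) for any $x,y\in X$, either $C_{\mathfrak{a}}(x)=C_{\mathfrak{a}}(y)$ or $C_{\mathfrak{a}}(x)\cap C_{\mathfrak{a}}(y)=\emptyset$; (d) $X$ is the disjoint union of the distinct $\mathfrak{a}$-components $C_{\mathfrak{a}}(x)$, $x\in X$.
   Context: An aura topological space (or $\mathfrak{a}$-space) $(X,\tau,\mathfrak{a})$ is a topological space $(X,\tau)$ together with a function $\mathfrak{a}:X\to\tau$ (a scope function) such that $x\in\mathfrak{a}(x)$ for every $x\in X$. A subset $A\subseteq X$ is $\mathfrak{a}$-open if $\mathfrak{a}(x)\subseteq A$ for every $x\in A$; the collection $\tau_{\mathfrak{a}}$ of all $\mathfrak{a}$-open sets is a topology on $X$ with $\tau_{\mathfrak{a}}\subseteq\tau$. A subset $F\subseteq X$ is $\mathfrak{a}$-closed if $X\setminus F\in\tau_{\mathfrak{a}}$. The space $(X,\tau,\mathfrak{a})$ is $\mathfrak{a}$-disconnected if there exist nonempty disjoint $U,V\in\tau_{\mathfrak{a}}$ with $X=U\cup V$, and $\mathfrak{a}$-connected otherwise. For a nonempty subset $Y\subseteq X$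 with subspace topology $\tau_Y$, the subspace scope function is $\mathfrak{a}_Y(y)=\mathfrak{a}(y)\cap Y$, and $(Y,\tau_Y,\mathfrak{a}_Y)$ is the subspace aura space; its topology $\tau_{\mathfrak{a}_Y}$ consists of the sets $V\subseteq Y$ with $\mathfrak{a}(y)\cap Y\subseteq V$ for all $y\in V$. A subset $Y\subseteq X$ is called $\mathfrak{a}$-connected if the subspace aura space $(Y,\tau_Y,\mathfrak{a}_Y)$ is $\mathfrak{a}_Y$-connected. The $\mathfrak{a}$-component of $x\in X$ is $C_{\mathfrak{a}}(x)=\bigcup\{A\subseteq X: x\in A \text{ and } A \text{ is } \mathfrak{a}\text{-connected}\}$. *)

(* Defs.v *)
From HB Require Import structures.
From mathcomp Require Import all_boot all_order.
From mathcomp Require Import all_classical topology.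

Set Implicit Arguments.
Unset Strict Implicit.
Unset Printing Implicit Defensive.

Local Open Scope classical_set_scope.

Record scope_function (X : topologicalType) := ScopeFunction {
  scope :> X -> set X ;
  scope_open : forall x, open (scope x) ;
  scope_mem : forall x, scope x x }.

Section AuraSpace.
Variables (X : topologicalType) (a : scope_function X).

Definition aura_open (A : set X) := forall x, A x -> a x `<=` A.

Definition aura_closed (F : set X) := aura_open (~` F).

Definition aura_disconnected := exists U V : set X,
  [/\ U !=set0, V !=set0, U `&` V = set0, aura_open U /\ aura_open V
    & setT = U `|` V].

Definition aura_connected := ~ aura_disconnected.

Lemma aura_open_open (A : set X) : aura_open A -> open A.
Proof.
move=> oA; rewrite (_ : A = \bigcup_(x in A) a x).
  by apply: bigcup_open => x _; exact: scope_open.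
apply/seteqP; split=> [x Ax|x [y Ay]]; last exact: oA.
by exists x => //; exact: scope_mem.
Qed.

Lemma aura_openT : aura_open setT.
Proof. by []. Qed.

Lemma aura_openI (A B : set X) :
  aura_open A -> aura_open B -> aura_open (A `&` B).
Proof.
by move=> oA oB x [Ax Bx] y ay; split; [exact: oA ay | exact: oB ay].
Qed.

Lemma aura_open_bigcup (I : Type) (D : set I) (F : I -> set X) :
  (forall i, D i -> aura_open (F i)) -> aura_open (\bigcup_(i in D) F i).
Proof.
by move=> oF x [i Di Fix] y ay; exists i => //; exact: oF ay.
Qed.

(* The carrier [set_type Y] has the subspace topology (the initial topology
   for the inclusion [set_val]). *)
Definition subspace_scope_fun (Y : set X) (y : set_type Y) :
  set (set_type Y) := set_val @^-1` a (set_val y).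

Lemma subspace_scope_open (Y : set X) (y : set_type Y) :
  open (subspace_scope_fun y).
Proof. by exists (a (set_val y)) => //; exact: scope_open. Qed.

Lemma subspace_scope_mem (Y : set X) (y : set_type Y) :
  subspace_scope_fun y y.
Proof. exact: scope_mem. Qed.

Definition subspace_scope (Y : set X) : scope_function (set_type Y) :=
  ScopeFunction (@subspace_scope_open Y) (@subspace_scope_mem Y).

End AuraSpace.

Lemma subspace_scopeE (X : topologicalType) (a : scope_function X) (Y : set X)
    (y : set_type Y) :
  set_val @` subspace_scope a Y y = a (set_val y) `&` Y.
Proof.
apply/seteqP; split=> [_ [z az <-]|z [az Yz]].
  by split; [exact: az | exact: set_valP].
by exists (exist _ z (mem_set Yz)).
Qed.

Section Components.
Variables (X : topologicalType) (a : scope_function X).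

(* Subspace aura spaces are only formed on nonempty subsets. *)
Definition aura_connected_set (Y : set X) :=
  Y !=set0 /\ aura_connected (subspace_scope a Y).

Definition aura_component (x : X) : set X :=
  \bigcup_(A in [set A : set X | A x /\ aura_connected_set A]) A.

End Components.

(* Main.v *)
(* Read [a y z] as an edge from y to z. A nonempty set Y is connected iff every
   predicate S that takes the same value at the two ends of each edge inside Y
   is constant on Y. Unions of connected sets through a common point are then
   connected, and so is a connected set enlarged by a point z having an edge
   into it; the latter says that no scope a z with z outside a component can
   meet that component, i.e. components are closed. *)

Require Import Defs.
From mathcomp Require Import all_boot all_order.
From mathcomp Require Import all_classical topology.

Local Open Scope classical_set_scope.

Section ConnectedSets.
Set Implicit Arguments.
Unset Strict Implicit.
Variables (X : topologicalType) (a : scope_function X).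
Implicit Types (A Y S : set X) (x y z w : X).

(** Compatibility of [S] with the edges inside [Y] says exactly that the traces on [Y] of [S] and of
    its complement are both open for the subspace scope, so a nonconstant [S] amounts to a
    separation of [Y]. *)
Lemma aura_connected_setP Y : aura_connected_set a Y <->
  Y !=set0 /\
  forall S, (forall y z, Y y -> Y z -> a y z -> (S y <-> S z)) ->
  forall y z, Y y -> Y z -> S y -> S z.
Proof.
split=> [[Y0 Yc]|[Y0 Yc]]; split=> //.
  move=> S aS y z Yy Yz Sy; apply: contrapT => nSz; apply: Yc.
  have YP (u : set_type Y) : Y (set_val u) by exact: set_valP.
  exists (set_val @^-1` S), (set_val @^-1` (~` S)); split.
  - by exists (exist _ y (mem_set Yy)).
  - by exists (exist _ z (mem_set Yz)).
  - by rewrite -preimage_setI setICr preimage_set0.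
  - split=> u Su v auv.
      exact: (aS _ _ (YP u) (YP v) auv).1.
    by move=> Sv; apply: Su; exact: (aS _ _ (YP u) (YP v) auv).2.
  - by rewrite -preimage_setU setUCr preimage_setT.
move=> [U [V [[u Uu] [v Vv] UV0 [oU oV] UVT]]].
have nUV (w : set_type Y) : U w -> V w -> False.
  by move=> Uw Vw; have : (U `&` V) w by []; rewrite UV0.
(* Forwards along the edge, openness of [U] suffices. Backwards, if [y] were in [V], openness of [V]
   would put [z] in both pieces. *)
have aU y z : Y y -> Y z -> a y z ->
    ((set_val @` U) y <-> (set_val @` U) z).
  move=> Yy Yz ayz; split=> -[w Uw wE].
    exists (exist _ z (mem_set Yz)) => //.
    by apply: (oU _ Uw); rewrite /= /subspace_scope_fun/= wE.
  pose y' : set_type Y := exist _ y (mem_set Yy).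
  have [Uy|Vy] : (U `|` V) y' by rewrite -UVT.
    by exists y'.
  exfalso; apply: (nUV w) => //.
  by apply: (oV _ Vy); rewrite /= /subspace_scope_fun/= wE.
have [|w Uw wv] := Yc _ aU _ _ (set_valP u) (set_valP v); first by exists u.
by apply: (nUV v) => //; rewrite -(val_inj wv).
Qed.

Lemma aura_connected_set1 x : aura_connected_set a [set x].
Proof.
by apply/aura_connected_setP; split=> [|S _ y z -> ->//]; exists x.
Qed.

(** The truth of [S] passes from [y] to [x] inside one member and from [x] to [z] inside another,
    since edges inside a member are edges inside the union. *)
Lemma aura_connected_bigcup (D : set (set X)) x :
  D !=set0 -> (forall A, D A -> A x /\ aura_connected_set a A) ->
  aura_connected_set a (\bigcup_(A in D) A).
Proof.
move=> [A0 DA0] Dc; apply/aura_connected_setP; split.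
  by exists x, A0 => //; have [] := Dc _ DA0.
move=> S aS y z [A DA Ay] [B DB Bz] Sy.
have [Ax /aura_connected_setP[_ Ac]] := Dc _ DA.
have [Bx /aura_connected_setP[_ Bc]] := Dc _ DB.
have Sx : S x.
  by apply: (Ac S _ y) => // u v Au Av; apply: aS; exists A.
by apply: (Bc S _ x) => // u v Bu Bv; apply: aS; exists B.
Qed.

(** [S] is constant on [A], and the edge from [z] to [w] forces the same value at [z]. *)
Lemma aura_connected_setU1 A z w :
  aura_connected_set a A -> A w -> a z w -> aura_connected_set a (z |` A).
Proof.
move=> /aura_connected_setP[_ Ac] Aw azw; apply/aura_connected_setP.
split=> [|S aS]; first by exists z; left.
have SA y : A y -> S w <-> S y.
  have aSA u v : A u -> A v -> a u v -> (S u <-> S v).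
    by move=> Au Av; apply: aS; right.
  by move=> Ay; split; apply: (Ac S).
have Sz : S z <-> S w by apply: aS => //; [left | right].
have Sw y : (z |` A) y -> S w <-> S y.
  by move=> [->|/SA//]; split=> /Sz.
by move=> y y' /Sw Sy /Sw Sy' /Sy /Sy'.
Qed.

Lemma aura_component_refl x : aura_component a x x.
Proof.
by exists [set x] => //; split=> //; exact: aura_connected_set1.
Qed.

Lemma aura_component_max x A :
  A x -> aura_connected_set a A -> A `<=` aura_component a x.
Proof. by move=> Ax Ac y Ay; exists A. Qed.

Lemma aura_component_connected x :
  aura_connected_set a (aura_component a x).
Proof.
apply: (@aura_connected_bigcup _ x) => //.
by exists [set x]; split=> //; exact: aura_connected_set1.
Qed.

Lemma aura_component_closed x : aura_closed a (aura_component a x).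
Proof.
move=> z nCz w azw Cw; apply: nCz.
(* The component enlarged by [z] is connected and still contains [x], so maximality puts [z] in the
   component. *)
have Cc := aura_connected_setU1 (aura_component_connected x) Cw azw.
by apply: (aura_component_max _ Cc); [right; exact: aura_component_refl | left].
Qed.

(** The component of [x] is a connected set through [y], hence lies in that of [y]; then [x] is in
    the component of [y] and the argument reverses. *)
Lemma aura_component_eq x y :
  aura_component a x y -> aura_component a x = aura_component a y.
Proof.
move=> Cxy; have xy : aura_component a x `<=` aura_component a y.
  exact: (aura_component_max Cxy (aura_component_connected x)).
apply/seteqP; split=> //.
apply: (aura_component_max _ (aura_component_connected y)).
by apply: xy; exact: aura_component_refl.
Qed.

End ConnectedSets.

Theorem theorem4p8 (X : topologicalType) (a : scope_function X) :
  [/\ forall x : X,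
        [/\ aura_connected_set a (aura_component a x),
            aura_component a x x
          & forall A : set X, A x -> aura_connected_set a A ->
              A `<=` aura_component a x],
      forall x : X, aura_closed a (aura_component a x),
      forall x y : X,
        aura_component a x = aura_component a y \/
        aura_component a x `&` aura_component a y = set0
    & cover (range (aura_component a)) id = setT /\
      trivIset (range (aura_component a)) id].
Proof.
split=> [x|x|x y|].
- split; first exact: aura_component_connected.
    exact: aura_component_refl.
  by move=> A; exact: aura_component_max.
- exact: aura_component_closed.
(* Through a common point [z], both components equal that of [z]. *)
- have [->|/set0P[z [Cxz Cyz]]] :=
    eqVneq (aura_component a x `&` aura_component a y) set0; first by right.
  by left; rewrite (aura_component_eq Cxz) (aura_component_eq Cyz).
- split.
    apply/seteqP; split=> // x _; exists (aura_component a x).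
      by exists x.
    exact: aura_component_refl.
  (* The family is indexed by the components themselves, so it is enough that two of them meeting in
     [z] coincide. *)
  move=> _ _ [x _ <-] [y _ <-] [z [Cxz Cyz]].
  by rewrite (aura_component_eq Cxz) (aura_component_eq Cyz).
Qed.
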